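(* Let $\mathcal{M}$ be a multicategory and let $t,t'$ be terms of $T(\mathcal{M})$. If $t \stackrel{*}{\leftrightarrow} t'$ then $\llbracket t \rrbracket = \llbracket t' \rrbracket$ as cells of the free cornering ${}^\ulcorner_\llcorner F(\mathcal{M})^\urcorner_\lrcorner$ of the free strict monoidal category $F(\mathcal{M})$ on $\mathcal{M}$.
   Context: **Multicategory notation.** Fix a multicategory $\mathcal{M}$ with set of objects $\mathcal{M}_0$. Morphisms are written in sequent notation: $x_1{:}A_1,\ldots,x_n{:}A_n \vdash v : A$ ($n \ge 0$, distinct variables) denotes a morphism $v \in \mathcal{M}(A_1,\ldots,A_n;A)$; $x{:}A \vdash x : A$ denotes the identity, and for $\Gamma_i \vdash v_i : A_i$ the substitution $v[v_1,\ldots,v_n/x_1,\ldots,x_n]$ denotes the composite $v \circ (v_1,\ldots,v_n)$; expressions denoting the same morphism of $\mathcal{M}$ are identified. Contexts $\Gamma$ are ordered lists of typed variables without repeated variables. For a set $X$, $X^{\circ\bullet} = (X \times \{\circ,\bullet\})^*$ is the free monoid on polarised elements $A^\circ, A^\bullet$ ($A \in X$), with empty word $\lambda$ (also written $I$). **Terms.** $T(\mathcal{M})$ consists of the terms $t$ with $\Gamma \Vdash t : (U,B,W)$ (where $U,W \in \mathcal{M}_0^{\circ\bullet}$, $B \in \mathcal{M}_0$) derivable by the following rules (bound variables may be renamed): - (seq) if $\Gamma \vdash v : A$ then $\Gamma \Vdash [v] : (\lambda,A,\lambda)$; - (let) if $n \ge 1$, $\Gamma_i \Vdash t_i : (U_{i-1},A_i,U_i)$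 for $1 \le i \le n$, and $x_1{:}A_1,\ldots,x_n{:}A_n \Vdash t : (V,B,W)$, then $\Gamma_1,\ldots,\Gamma_n \Vdash \mathsf{let}\ x_1,\ldots,x_n \downarrow (t_1 \mid \cdots \mid t_n)\ \mathsf{in}\ t : (U_0V,B,U_nW)$; - (putR) if $\Delta \Vdash t : (U,B,W)$ and $\Gamma \vdash v : A$ then $\Delta,\Gamma \Vdash \mathsf{putR}(v,t) : (U,B,A^\circ W)$; - (getL) if $x{:}A,\Gamma \Vdash t : (U,B,W)$ then $\Gamma \Vdash \mathsf{getL}(x.t) : (A^\circ U,B,W)$; - (getR) if $\Gamma,x{:}A \Vdash t : (U,B,W)$ then $\Gamma \Vdash \mathsf{getR}(x.t) : (U,B,A^\bullet W)$; - (putL) if $\Gamma \vdash v : A$ and $\Delta \Vdash t : (U,B,W)$ then $\Gamma,\Delta \Vdash \mathsf{putL}(v,t) : (A^\bullet U,B,W)$. **Value substitution.** For $\Gamma_i \vdash v_i : A_i$ ($1\le i\le n$) and $x_1{:}A_1,\ldots,x_n{:}A_n \Vdash t : (U,B,W)$, the term $\Gamma_1,\ldots,\Gamma_n \Vdash t[\overline v/\overline x] : (U,B,W)$ is defined by recursion: $[u][\overline v/\overline x] = [u[\overline v/\overline x]]$; $\mathsf{putR}(u,s)[\overline v/\overline x] = \mathsf{putR}(u[\overline{v_2}/\overline{x_2}],s[\overline{v_1}/\overline{x_1}])$ and $\mathsf{putL}(u,s)[\overline v/\overline x] = \mathsf{putL}(u[\overline{v_1}/\overline{x_1}],s[\overline{v_2}/\overline{x_2}])$,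 where $\overline x = \overline{x_1},\overline{x_2}$ is split as dictated by the typing rule (and $\overline v$ accordingly); $\mathsf{getL}(y.s)[\overline v/\overline x] = \mathsf{getL}(y.s[\overline v/\overline x])$ and $\mathsf{getR}(y.s)[\overline v/\overline x] = \mathsf{getR}(y.s[\overline v/\overline x])$ ($y$ being substituted for itself); $(\mathsf{let}\ \overline y \downarrow (t_1 \mid \cdots \mid t_m)\ \mathsf{in}\ s)[\overline v/\overline x] = \mathsf{let}\ \overline y \downarrow (t_1[\overline{v_1}/\overline{x_1}] \mid \cdots \mid t_m[\overline{v_m}/\overline{x_m}])\ \mathsf{in}\ s$ with $\overline x$ split into the contexts $\overline{x_j}$ of the $t_j$. Variables substituted for themselves may be omitted, as in $t[v/y]$. **Rewriting.** $\to$ is the least relation on terms closed under all term formers (i.e. under rewriting subterms) containing (where $\overline a,\overline b$ are possibly empty sequences of terms): - [R0] $\mathsf{let}\ x_1,\ldots,x_n \downarrow ([v_1] \mid \cdots \mid [v_n])\ \mathsf{in}\ t \to t[v_1,\ldots,v_n/x_1,\ldots,x_n]$ - [R1] $\mathsf{let}\ \overline x \downarrow (\overline a \mid \mathsf{putR}(v,t) \mid \mathsf{getL}(y.s) \mid \overline b)\ \mathsf{in}\ r \to \mathsf{let}\ \overline x \downarrow (\overline a \mid t \mid s[v/y] \mid \overline b)\ \mathsf{in}\ r$ - [R2] $\mathsf{let}\ \overline x \downarrow (\overline a \mid \mathsf{getR}(y.t) \mid \mathsf{putL}(v,s) \mid \overline b)\ \mathsf{in}\ r \to \mathsf{let}\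 \overline x \downarrow (\overline a \mid t[v/y] \mid s \mid \overline b)\ \mathsf{in}\ r$ - [R3] $\mathsf{let}\ \overline x \downarrow (\mathsf{putL}(v,t) \mid \overline a)\ \mathsf{in}\ r \to \mathsf{putL}(v,\mathsf{let}\ \overline x \downarrow (t \mid \overline a)\ \mathsf{in}\ r)$ - [R4] $\mathsf{let}\ \overline x \downarrow (\mathsf{getL}(y.t) \mid \overline a)\ \mathsf{in}\ r \to \mathsf{getL}(y.\mathsf{let}\ \overline x \downarrow (t \mid \overline a)\ \mathsf{in}\ r)$ - [R5] $\mathsf{let}\ \overline x \downarrow (\overline a \mid \mathsf{putR}(v,t))\ \mathsf{in}\ r \to \mathsf{putR}(v,\mathsf{let}\ \overline x \downarrow (\overline a \mid t)\ \mathsf{in}\ r)$ - [R6] $\mathsf{let}\ \overline x \downarrow (\overline a \mid \mathsf{getR}(y.t))\ \mathsf{in}\ r \to \mathsf{getR}(y.\mathsf{let}\ \overline x \downarrow (\overline a \mid t)\ \mathsf{in}\ r)$ - [R7] $\mathsf{putR}(v,\mathsf{putL}(w,t)) \to \mathsf{putL}(w,\mathsf{putR}(v,t))$ - [R8] $\mathsf{putR}(v,\mathsf{getL}(x.t)) \to \mathsf{getL}(x.\mathsf{putR}(v,t))$ when $x$ does not occur in $v$ - [R9] $\mathsf{getR}(x.\mathsf{putL}(v,t)) \to \mathsf{putL}(v,\mathsf{getR}(x.t))$ when $x$ does not occur in $v$ - [R10] $\mathsf{getR}(x.\mathsf{getL}(y.t)) \to \mathsf{getL}(y.\mathsf{getR}(x.t))$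 $\stackrel{*}{\leftrightarrow}$ (convertibility) is the reflexive symmetric transitive closure of $\to$. **Free cornering.** For a strict monoidal category $\mathbb{A}$ with object monoid $(\mathbb{A}_0,\otimes,I)$, the free cornering ${}^\ulcorner_\llcorner\mathbb{A}^\urcorner_\lrcorner$ is the single-object strict double category with horizontal edge monoid $(\mathbb{A}_0,\otimes,I)$, vertical edge monoid $\mathbb{A}_0^{\circ\bullet}$, and cells (typed $(U;A;B;W)$ = (left; top; bottom; right)) freely generated by: ${}^\ulcorner_\llcorner f^\urcorner_\lrcorner:(\lambda;A;B;\lambda)$ for $f \in \mathbb{A}(A,B)$; corner cells $A\urcorner:(A^\circ;I;A;\lambda)$, $A\llcorner:(\lambda;A;I;A^\circ)$, $A\ulcorner:(\lambda;I;A;A^\bullet)$, $A\lrcorner:(A^\bullet;A;I;\lambda)$ for $A \in \mathbb{A}_0$; vertical identities $1_A:(\lambda;A;A;\lambda)$; horizontal identities $id_U:(U;I;I;U)$; vertical composites $a\cdot b:(UU';A;C;WW')$ for $a:(U;A;B;W)$, $b:(U';B;C;W')$; horizontal composites $a\mid b:(U;A\otimes A';B\otimes B';V)$ for $a:(U;A;B;W)$, $b:(W;A';B';V)$; subject to: ${}^\ulcorner_\llcorner f^\urcorner_\lrcorner\cdot{}^\ulcorner_\llcorner g^\urcorner_\lrcorner={}^\ulcorner_\llcorner fg^\urcorner_\lrcorner$ (diagrammatic order), ${}^\ulcorner_\llcorner f^\urcorner_\lrcorner\mid{}^\ulcorner_\llcorner g^\urcorner_\lrcorner={}^\ulcorner_\llcorner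 f\otimes g^\urcorner_\lrcorner$, $1_A={}^\ulcorner_\llcorner 1_A{}^\urcorner_\lrcorner$; yanking: $A\llcorner\mid A\urcorner=1_A$, $A\ulcorner\mid A\lrcorner=1_A$, $A\urcorner\cdot A\llcorner=id_{A^\circ}$, $A\ulcorner\cdot A\lrcorner=id_{A^\bullet}$; and the strict double category axioms: $\cdot$ and $\mid$ are associative with units $1_A$ and $id_U$ respectively, $(a\mid b)\cdot(c\mid d)=(a\cdot c)\mid(b\cdot d)$, $id_\lambda=1_I$, $id_U\cdot id_W=id_{UW}$. **Free monoidal category.** $F(\mathcal{M})$ has object monoid $\mathcal{M}_0^*$; morphisms from $\Gamma_1,\ldots,\Gamma_n$ to $A_1,\ldots,A_n$ are sequences $(f_1,\ldots,f_n)$ with $f_i\in\mathcal{M}(\Gamma_i;A_i)$; composition and identities are induced from $\mathcal{M}$; tensor is concatenation. **Interpretation.** An object $A$ of $\mathcal{M}$ is identified with the one-element word $(A)$, and $\mathcal{M}_0^{\circ\bullet}$ with the corresponding submonoid of $(\mathcal{M}_0^* )^{\circ\bullet}$. For $x_1{:}A_1,\ldots,x_n{:}A_n\Vdash t:(U,B,W)$ the cell $\llbracket t\rrbracket$ of ${}^\ulcorner_\llcorner F(\mathcal{M})^\urcorner_\lrcorner$ of type $(U;A_1,\ldots,A_n;B;W)$ is: $\llbracket[v]\rrbracket={}^\ulcorner_\llcorner(v)^\urcorner_\lrcorner$; $\llbracket\mathsf{let}\ \overline y\downarrow(t_1\mid\cdots\mid t_m)\ \mathsf{in}\ t'\rrbracket=(\llbracket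 t_1\rrbracket\mid\cdots\mid\llbracket t_m\rrbracket)\cdot\llbracket t'\rrbracket$; $\llbracket\mathsf{putL}(v,t')\rrbracket=(({}^\ulcorner_\llcorner(v)^\urcorner_\lrcorner\cdot A\lrcorner)\mid 1_\Delta)\cdot\llbracket t'\rrbracket$; $\llbracket\mathsf{getL}(x.t')\rrbracket=(A\urcorner\mid 1_\Gamma)\cdot\llbracket t'\rrbracket$; $\llbracket\mathsf{getR}(x.t')\rrbracket=(1_\Gamma\mid A\ulcorner)\cdot\llbracket t'\rrbracket$; $\llbracket\mathsf{putR}(v,t')\rrbracket=(1_\Delta\mid({}^\ulcorner_\llcorner(v)^\urcorner_\lrcorner\cdot A\llcorner))\cdot\llbracket t'\rrbracket$, with $A,\Gamma,\Delta$ as in the typing rules. *)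

(* Defs.v *)
From Stdlib Require Import Relation_Operators.
From mathcomp Require Import all_boot.

Set Implicit Arguments.
Unset Strict Implicit.
Unset Printing Implicit Defensive.

(* Single-sorted presentation: M(A_1,...,A_n; A) is the collection of the
   [v : mor] with [mdom v = [:: A_1; ...; A_n]] and [mcod v = A]. The composite
   [mcomp v vs], i.e. v o (v_1,...,v_n), is a total function about which
   nothing is assumed unless [map mcod vs = mdom v]. Composition with
   identities and associativity then need no transport along equalities between
   concatenated lists. *)
Record multicategory := Multicategory {
  ob :> Type;
  mor : Type;
  mdom : mor -> seq ob;
  mcod : mor -> ob;
  mid : ob -> mor;
  mcomp : mor -> seq mor -> mor;
  mdom_id : forall A, mdom (mid A) = [:: A];
  mcod_id : forall A, mcod (mid A) = A;
  mdom_comp : forall v vs, map mcod vs = mdom v ->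
    mdom (mcomp v vs) = flatten (map mdom vs);
  mcod_comp : forall v vs, map mcod vs = mdom v ->
    mcod (mcomp v vs) = mcod v;
  mcomp_idl : forall v, mcomp (mid (mcod v)) [:: v] = v;
  mcomp_idr : forall v, mcomp v (map mid (mdom v)) = v;
  mcompA : forall v vs (wss : seq (seq mor)),
    map mcod vs = mdom v -> map (map mcod) wss = map mdom vs ->
    mcomp (mcomp v vs) (flatten wss)
    = mcomp v [seq mcomp p.1 p.2 | p <- zip vs wss]
}.
Arguments mor M : rename.
Arguments mdom {M} v : rename.
Arguments mcod {M} v : rename.
Arguments mid {M} A : rename.
Arguments mcomp {M} v vs : rename.

(* Also single-sorted; [scomp f g] is in diagrammatic order and is only
   meaningful when [scod f = sdom g]. *)
Record strict_monoidal_category := StrictMonoidalCategory {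
  sob :> Type;
  smor : Type;
  sdom : smor -> sob;
  scod : smor -> sob;
  sid : sob -> smor;
  scomp : smor -> smor -> smor;
  sunit : sob;
  sten : sob -> sob -> sob;
  stenm : smor -> smor -> smor;
  stenA : forall A B C, sten A (sten B C) = sten (sten A B) C;
  sten1l : forall A, sten sunit A = A;
  sten1r : forall A, sten A sunit = A;
  sdom_id : forall A, sdom (sid A) = A;
  scod_id : forall A, scod (sid A) = A;
  sdom_comp : forall f g, scod f = sdom g -> sdom (scomp f g) = sdom f;
  scod_comp : forall f g, scod f = sdom g -> scod (scomp f g) = scod g;
  scomp_idl : forall f, scomp (sid (sdom f)) f = f;
  scomp_idr : forall f, scomp f (sid (scod f)) = f;
  scompA : forall f g h, scod f = sdom g -> scod g = sdom h ->
    scomp f (scomp g h) = scomp (scomp f g) h;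
  sdom_ten : forall f g, sdom (stenm f g) = sten (sdom f) (sdom g);
  scod_ten : forall f g, scod (stenm f g) = sten (scod f) (scod g);
  stenmA : forall f g h, stenm f (stenm g h) = stenm (stenm f g) h;
  stenm1l : forall f, stenm (sid sunit) f = f;
  stenm1r : forall f, stenm f (sid sunit) = f;
  stenm_id : forall A B, stenm (sid A) (sid B) = sid (sten A B);
  stenm_comp : forall f f' g g', scod f = sdom f' -> scod g = sdom g' ->
    stenm (scomp f f') (scomp g g') = scomp (stenm f g) (stenm f' g')
}.
Arguments smor S : rename.
Arguments sdom {S} f : rename.
Arguments scod {S} f : rename.
Arguments sid {S} A : rename.
Arguments scomp {S} f g : rename.
Arguments sunit {S} : rename.
Arguments sten {S} A B : rename.
Arguments stenm {S} f g : rename.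

(* Every sequence (f_1,...,f_n) of morphisms of M is a morphism of F(M), from
   the concatenation of the domains of the f_i to the list of their
   codomains. *)
Section FreeMonoidal.
Variable M : multicategory.
Implicit Types fs gs hs : seq (mor M).

Definition fdom fs : seq M := flatten (map mdom fs).
Definition fcod fs : seq M := map mcod fs.
Definition fid (As : seq M) : seq (mor M) := map mid As.

Fixpoint fcomp fs gs : seq (mor M) :=
  if gs is g :: gs' then
    mcomp g (take (size (mdom g)) fs) :: fcomp (drop (size (mdom g)) fs) gs'
  else [::].

Lemma fcod_cat fs gs : fcod (fs ++ gs) = fcod fs ++ fcod gs.
Proof. exact: map_cat. Qed.

Lemma fdom_cat fs gs : fdom (fs ++ gs) = fdom fs ++ fdom gs.
Proof. by rewrite /fdom map_cat flatten_cat. Qed.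

Lemma fdom_id As : fdom (fid As) = As.
Proof. by elim: As => //= A As IH; rewrite /fdom /= mdom_id -[RHS]/([:: A] ++ As) -{2}IH. Qed.

Lemma fcod_id As : fcod (fid As) = As.
Proof. by elim: As => //= A As ->; rewrite mcod_id. Qed.

Lemma fcod_split fs G D : fcod fs = G ++ D ->
  [/\ fcod (take (size G) fs) = G & fcod (drop (size G) fs) = D].
Proof.
by move=> e; rewrite /fcod map_take map_drop -/(fcod fs) e take_size_cat
  ?drop_size_cat.
Qed.

Lemma fcod_comp fs gs : fcod fs = fdom gs -> fcod (fcomp fs gs) = fcod gs.
Proof.
elim: gs fs => //= g gs IH fs /fcod_split [e1 e2].
by rewrite IH // mcod_comp.
Qed.

Lemma fdom_comp fs gs : fcod fs = fdom gs -> fdom (fcomp fs gs) = fdom fs.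
Proof.
elim: gs fs => [[]|g gs IH fs /fcod_split [e1 e2]] //=.
rewrite -[in RHS](cat_take_drop (size (mdom g)) fs) fdom_cat -(IH _ e2).
by rewrite /fdom /= mdom_comp.
Qed.

Lemma fcomp_idr fs : fcomp fs (fid (fcod fs)) = fs.
Proof. by elim: fs => //= f fs IH; rewrite mdom_id /= take0 drop0 mcomp_idl IH. Qed.

Lemma fcomp_idl fs : fcomp (fid (fdom fs)) fs = fs.
Proof.
elim: fs => //= f fs IH; rewrite /fid /fdom /= map_cat.
by rewrite take_size_cat ?drop_size_cat ?size_map // mcomp_idr IH.
Qed.

Lemma fcomp_cat fs fs' gs gs' : fcod fs = fdom gs ->
  fcomp (fs ++ fs') (gs ++ gs') = fcomp fs gs ++ fcomp fs' gs'.
Proof.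
elim: gs fs => [[]|g gs IH fs /fcod_split [e1 e2]] //=.
rewrite -(cat_take_drop (size (mdom g)) fs) -catA.
have s1 : size (take (size (mdom g)) fs) = size (mdom g).
  by move/(congr1 size): e1; rewrite size_map.
by rewrite take_size_cat // take_size_cat // !drop_size_cat // IH.
Qed.

Lemma mcomp_fcomp h fs gs : fcod fs = fdom gs -> fcod gs = mdom h ->
  mcomp h (fcomp fs gs) = mcomp (mcomp h gs) fs.
Proof.
move=> e1 e2.
have [wss [-> <- ec]] : exists wss, [/\ fs = flatten wss,
    [seq mcomp p.1 p.2 | p <- zip gs wss] = fcomp fs gs &
    map (map mcod) wss = map mdom gs].
  elim: gs fs e1 {e2} => [[]|g gs IH fs /fcod_split [e1 e2]] //=.
    by exists [::].
  have [wss [ew ez ec]] := IH _ e2.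
  exists (take (size (mdom g)) fs :: wss); split=> /=.
  - by rewrite -ew cat_take_drop.
  - by rewrite ez.
  - by congr (_ :: _).
by rewrite mcompA.
Qed.

Lemma fcompA fs gs hs : fcod fs = fdom gs -> fcod gs = fdom hs ->
  fcomp fs (fcomp gs hs) = fcomp (fcomp fs gs) hs.
Proof.
elim: hs fs gs => //= h hs IH fs gs e /[dup] e' /fcod_split [e1 e2].
rewrite (mdom_comp e1).
set gs1 := take _ gs in e1 *; set gs2 := drop _ gs in e2 *.
have egs : gs = gs1 ++ gs2 by rewrite cat_take_drop.
have := e; rewrite egs fdom_cat => /fcod_split [f1 f2].
set fs1 := take _ fs in f1 *; set fs2 := drop _ fs in f2 *.
have efs : fs = fs1 ++ fs2 by rewrite cat_take_drop.
have s1 : size (fcomp fs1 gs1) = size (mdom h).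
  by rewrite -(size_map mcod) -/(fcod _) fcod_comp // -e1 size_map.
rewrite efs fcomp_cat // take_size_cat // drop_size_cat // mcomp_fcomp //.
by rewrite IH.
Qed.

Definition free_smc : strict_monoidal_category.
Proof.
refine (@StrictMonoidalCategory (seq M) (seq (mor M)) fdom fcod fid fcomp
  [::] cat cat _ _ _ fdom_id fcod_id fdom_comp fcod_comp fcomp_idl fcomp_idr
  fcompA fdom_cat fcod_cat _ _ _ _ _).
- exact: catA.
- by [].
- exact: cats0.
- exact: catA.
- by [].
- exact: cats0.
- by move=> A B; rewrite /fid map_cat.
- by move=> fs fs' gs gs' e _; rewrite fcomp_cat.
Defined.

End FreeMonoidal.

Inductive polarity := Circ | Bullet.

Definition polword (X : Type) := seq (X * polarity).

Definition circ (X : Type) (A : X) : X * polarity := (A, Circ).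
Definition bullet (X : Type) (A : X) : X * polarity := (A, Bullet).

(* The embedding of M_0^{o*} into (M_0^* )^{o*} induced by A |-> (A). *)
Definition word1 (X : Type) (U : polword X) : polword (seq X) :=
  [seq ([:: p.1], p.2) | p <- U].

Section FreeCornering.
Variable S : strict_monoidal_category.

(* [c_ur], [c_ll], [c_ul] and [c_lr] are the corners A-urcorner, A-llcorner,
   A-ulcorner and A-lrcorner; [c_one A] is the vertical identity 1_A and [c_id U]
   the horizontal identity id_U; [c_v a b] is a . b and [c_h a b] is a | b. *)
Inductive cexpr :=
| c_mor of smor S
| c_ur of S
| c_ll of S
| c_ul of S
| c_lr of S
| c_one of S
| c_id of polword S
| c_v of cexpr & cexpr
| c_h of cexpr & cexpr.

(* [ctyped a U A B W] : a is a cell of type (left; top; bottom; right) =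
   (U; A; B; W). *)
Inductive ctyped : cexpr -> polword S -> S -> S -> polword S -> Prop :=
| ct_mor f : ctyped (c_mor f) [::] (sdom f) (scod f) [::]
| ct_ur A : ctyped (c_ur A) [:: circ A] sunit A [::]
| ct_ll A : ctyped (c_ll A) [::] A sunit [:: circ A]
| ct_ul A : ctyped (c_ul A) [::] sunit A [:: bullet A]
| ct_lr A : ctyped (c_lr A) [:: bullet A] A sunit [::]
| ct_one A : ctyped (c_one A) [::] A A [::]
| ct_id U : ctyped (c_id U) U sunit sunit U
| ct_v a b U U' A B C W W' :
    ctyped a U A B W -> ctyped b U' B C W' ->
    ctyped (c_v a b) (U ++ U') A C (W ++ W')
| ct_h a b U V W A A' B B' :
    ctyped a U A B W -> ctyped b W A' B' V ->
    ctyped (c_h a b) U (sten A A') (sten B B') V.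

(* [ceq a b U A B W] : a and b denote the same cell of type (U; A; B; W) of the
   free cornering, i.e. they are identified by the congruence generated by its
   defining equations. *)
Inductive ceq :
  cexpr -> cexpr -> polword S -> S -> S -> polword S -> Prop :=
| ceq_refl a U A B W : ctyped a U A B W -> ceq a a U A B W
| ceq_sym a b U A B W : ceq a b U A B W -> ceq b a U A B W
| ceq_trans a b c U A B W :
    ceq a b U A B W -> ceq b c U A B W -> ceq a c U A B W
| ceq_v a a' b b' U U' A B C W W' :
    ceq a a' U A B W -> ceq b b' U' B C W' ->
    ceq (c_v a b) (c_v a' b') (U ++ U') A C (W ++ W')
| ceq_h a a' b b' U V W A A' B B' :
    ceq a a' U A B W -> ceq b b' W A' B' V ->
    ceq (c_h a b) (c_h a' b') U (sten A A') (sten B B') V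
| ceq_mor_comp f g : scod f = sdom g ->
    ceq (c_v (c_mor f) (c_mor g)) (c_mor (scomp f g))
      [::] (sdom f) (scod g) [::]
| ceq_mor_ten f g :
    ceq (c_h (c_mor f) (c_mor g)) (c_mor (stenm f g))
      [::] (sten (sdom f) (sdom g)) (sten (scod f) (scod g)) [::]
| ceq_mor_id A : ceq (c_one A) (c_mor (sid A)) [::] A A [::]
| ceq_yank_h_circ A :
    ceq (c_h (c_ll A) (c_ur A)) (c_one A) [::] A A [::]
| ceq_yank_h_bullet A :
    ceq (c_h (c_ul A) (c_lr A)) (c_one A) [::] A A [::]
| ceq_yank_v_circ A :
    ceq (c_v (c_ur A) (c_ll A)) (c_id [:: circ A])
      [:: circ A] sunit sunit [:: circ A]
| ceq_yank_v_bullet A :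
    ceq (c_v (c_ul A) (c_lr A)) (c_id [:: bullet A])
      [:: bullet A] sunit sunit [:: bullet A]
| ceq_vA a b c U U' U'' A B C D W W' W'' :
    ctyped a U A B W -> ctyped b U' B C W' -> ctyped c U'' C D W'' ->
    ceq (c_v a (c_v b c)) (c_v (c_v a b) c)
      (U ++ U' ++ U'') A D (W ++ W' ++ W'')
| ceq_v1l a U A B W : ctyped a U A B W -> ceq (c_v (c_one A) a) a U A B W
| ceq_v1r a U A B W : ctyped a U A B W -> ceq (c_v a (c_one B)) a U A B W
| ceq_hA a b c U V W X A A' A'' B B' B'' :
    ctyped a U A B V -> ctyped b V A' B' W -> ctyped c W A'' B'' X ->
    ceq (c_h a (c_h b c)) (c_h (c_h a b) c)
      U (sten A (sten A' A'')) (sten B (sten B' B'')) X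
| ceq_h1l a U A B W : ctyped a U A B W -> ceq (c_h (c_id U) a) a U A B W
| ceq_h1r a U A B W : ctyped a U A B W -> ceq (c_h a (c_id W)) a U A B W
| ceq_interchange a b c d U V W U' V' W' A A' B B' C C' :
    ctyped a U A B W -> ctyped b W A' B' V ->
    ctyped c U' B C W' -> ctyped d W' B' C' V' ->
    ceq (c_v (c_h a b) (c_h c d)) (c_h (c_v a c) (c_v b d))
      (U ++ U') (sten A A') (sten C C') (V ++ V')
| ceq_id_nil : ceq (c_id [::]) (c_one sunit) [::] sunit sunit [::]
| ceq_id_cat U W :
    ceq (c_v (c_id U) (c_id W)) (c_id (U ++ W))
      (U ++ W) sunit sunit (U ++ W).

Definition cell :=
  {a : cexpr | exists U A B W, ctyped a U A B W}.

Definition same_cell (a b : cell) : Prop :=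
  exists U A B W, ceq (sval a) (sval b) U A B W.

(* a_1 | ... | a_m for m >= 1; the value on the empty sequence is never used. *)
Fixpoint c_hs (s : seq cexpr) : cexpr :=
  match s with
  | [::] => c_id [::]
  | [:: a] => a
  | a :: s' => c_h a (c_hs s')
  end.

End FreeCornering.

(* Contexts are ordered and every variable is used exactly once, in order, so
   terms up to renaming of variables need no names or indices: a value
   x_1:A_1,...,x_n:A_n |- v : A is the morphism v itself, the variable bound by
   getL (resp. getR) is the first (resp. last) one of the body, and let binds
   all the variables of its body. The binders of getL and getR carry the type
   of the bound variable. *)
Section Terms.
Variable M : multicategory.

Inductive rawterm :=
| t_seq of mor M
| t_let of seq rawterm & rawterm  (* let x_1,..,x_n <- (t_1|..|t_n) in t *)
| t_putR of mor M & rawterm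
| t_getL of M & rawterm
| t_getR of M & rawterm
| t_putL of mor M & rawterm.

(* The list of the types of the free variables of a term. *)
Fixpoint ctx (t : rawterm) : seq M :=
  match t with
  | t_seq v => mdom v
  | t_let ts _ => flatten (map ctx ts)
  | t_putR v t => ctx t ++ mdom v
  | t_getL _ t => behead (ctx t)
  | t_getR _ t => take (size (ctx t)).-1 (ctx t)
  | t_putL v t => mdom v ++ ctx t
  end.

(* [typed G t U B W] is G ||- t : (U, B, W).
   [typeds G ts U As W] is G_i ||- t_i : (U_{i-1}, A_i, U_i) for all i, where
   G = G_1,...,G_n, U_0 = U and U_n = W. *)
Inductive typed : seq M -> rawterm -> polword M -> M -> polword M -> Prop :=
| ty_seq v : typed (mdom v) (t_seq v) [::] (mcod v) [::]
| ty_let G ts t U0 As Un V B W :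
    0 < size ts -> typeds G ts U0 As Un -> typed As t V B W ->
    typed G (t_let ts t) (U0 ++ V) B (Un ++ W)
| ty_putR D t v U B W :
    typed D t U B W ->
    typed (D ++ mdom v) (t_putR v t) U B (circ (mcod v) :: W)
| ty_getL A G t U B W :
    typed (A :: G) t U B W -> typed G (t_getL A t) (circ A :: U) B W
| ty_getR A G t U B W :
    typed (rcons G A) t U B W -> typed G (t_getR A t) U B (bullet A :: W)
| ty_putL D t v U B W :
    typed D t U B W ->
    typed (mdom v ++ D) (t_putL v t) (bullet (mcod v) :: U) B W
with typeds :
  seq M -> seq rawterm -> polword M -> seq M -> polword M -> Prop :=
| tys_nil U : typeds [::] [::] U [::] U
| tys_cons G D t ts U V W A As :
    typed G t U A V -> typeds D ts V As W ->
    typeds (G ++ D) (t :: ts) U (A :: As) W.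

Definition term := {t : rawterm | exists G U B W, typed G t U B W}.

(* Value substitution t[v_1,...,v_n/x_1,...,x_n], where x_1,...,x_n are all the
   variables of t. *)
Fixpoint subst (t : rawterm) (vs : seq (mor M)) : rawterm :=
  match t with
  | t_seq u => t_seq (mcomp u vs)
  | t_let ts s =>
      let fix substs ts vs :=
        if ts is t1 :: ts' then
          subst t1 (take (size (ctx t1)) vs)
            :: substs ts' (drop (size (ctx t1)) vs)
        else [::] in
      t_let (substs ts vs) s
  | t_putR u s =>
      t_putR (mcomp u (drop (size (ctx s)) vs))
        (subst s (take (size (ctx s)) vs))
  | t_getL A s => t_getL A (subst s (mid A :: vs))
  | t_getR A s => t_getR A (subst s (rcons vs (mid A)))
  | t_putL u s =>
      t_putL (mcomp u (take (size (mdom u)) vs))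
        (subst s (drop (size (mdom u)) vs))
  end.

Inductive step : rawterm -> rawterm -> Prop :=
| R0 vs t : step (t_let (map t_seq vs) t) (subst t vs)
| R1 a b v t A G s r : ctx s = A :: G ->
    step (t_let (a ++ [:: t_putR v t, t_getL A s & b]) r)
         (t_let (a ++ [:: t, subst s (v :: map mid G) & b]) r)
| R2 a b A G t v s r : ctx t = rcons G A ->
    step (t_let (a ++ [:: t_getR A t, t_putL v s & b]) r)
         (t_let (a ++ [:: subst t (rcons (map mid G) v), s & b]) r)
| R3 v t a r :
    step (t_let (t_putL v t :: a) r) (t_putL v (t_let (t :: a) r))
| R4 A t a r :
    step (t_let (t_getL A t :: a) r) (t_getL A (t_let (t :: a) r))
| R5 v t a r :
    step (t_let (rcons a (t_putR v t)) r) (t_putR v (t_let (rcons a t) r))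
| R6 A t a r :
    step (t_let (rcons a (t_getR A t)) r) (t_getR A (t_let (rcons a t) r))
| R7 v w t : step (t_putR v (t_putL w t)) (t_putL w (t_putR v t))
(* the variable bound by getL is not in scope in v *)
| R8 v A t : step (t_putR v (t_getL A t)) (t_getL A (t_putR v t))
(* the variable bound by getR is the last one of [mdom v ++ ctx t], so it does
   not occur in v exactly when [ctx t] is not empty *)
| R9 A v t : ctx t <> [::] ->
    step (t_getR A (t_putL v t)) (t_putL v (t_getR A t))
| R10 A C t : step (t_getR A (t_getL C t)) (t_getL C (t_getR A t))
| step_let_arg a t t' b r :
    step t t' -> step (t_let (a ++ t :: b) r) (t_let (a ++ t' :: b) r)
| step_let_body ts r r' : step r r' -> step (t_let ts r) (t_let ts r')
| step_putR v t t' : step t t' -> step (t_putR v t) (t_putR v t')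
| step_getL A t t' : step t t' -> step (t_getL A t) (t_getL A t')
| step_getR A t t' : step t t' -> step (t_getR A t) (t_getR A t')
| step_putL v t t' : step t t' -> step (t_putL v t) (t_putL v t').

(* Rewriting and conversion relate well-typed terms only, at every
   intermediate stage. *)
Definition red (t t' : term) : Prop := step (sval t) (sval t').

Definition convertible : term -> term -> Prop :=
  clos_refl_sym_trans term red.

End Terms.

Section Interpretation.
Variable M : multicategory.
Local Notation F := (free_smc M).

Fixpoint rinterp (t : rawterm M) : cexpr F :=
  match t with
  | t_seq v => c_mor ([:: v] : smor F)
  | t_let ts t' => c_v (c_hs (map rinterp ts)) (rinterp t')
  | t_putL v t' =>
      c_v (c_h (c_v (c_mor ([:: v] : smor F)) (c_lr ([:: mcod v] : F)))
               (c_one (ctx t' : F)))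
          (rinterp t')
  | t_getL A t' =>
      c_v (c_h (c_ur ([:: A] : F)) (c_one (ctx (t_getL A t') : F)))
          (rinterp t')
  | t_getR A t' =>
      c_v (c_h (c_one (ctx (t_getR A t') : F)) (c_ul ([:: A] : F)))
          (rinterp t')
  | t_putR v t' =>
      c_v (c_h (c_one (ctx t' : F))
               (c_v (c_mor ([:: v] : smor F)) (c_ll ([:: mcod v] : F))))
          (rinterp t')
  end.

Scheme typed_mind := Minimality for typed Sort Prop
  with typeds_mind := Minimality for typeds Sort Prop.

Lemma typed_ctx G (t : rawterm M) U B W : typed G t U B W -> ctx t = G.
Proof.
move: G t U B W; apply: (@typed_mind M (fun G t U B W => ctx t = G)
  (fun G ts U As W => flatten (map (@ctx M) ts) = G)) => //=.
- by move=> D t v U B W _ ->.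
- by move=> A G t U B W _ ->.
- by move=> A G t U B W _ ->; rewrite size_rcons /= -cats1 take_size_cat.
- by move=> D t v U B W _ ->.
- by move=> G D t ts U V W A As _ -> _ ->.
Qed.

Lemma word1_cat (X : Type) (U V : polword X) :
  word1 (U ++ V) = word1 U ++ word1 V.
Proof. exact: map_cat. Qed.

Lemma ctyped_ty (c : cexpr F) U A B W U' A' B' W' : ctyped c U A B W ->
  U = U' -> A = A' -> B = B' -> W = W' -> ctyped c U' A' B' W'.
Proof. by move=> H <- <- <- <-. Qed.

Lemma ctyped_mor1 (v : mor M) :
  ctyped (c_mor ([:: v] : smor F)) [::] (mdom v : F) ([:: mcod v] : F) [::].
Proof. by apply: (ctyped_ty (ct_mor _)) => //=; rewrite /fdom /= cats0. Qed.

(* The interpretation of G ||- t : (U, B, W) is a cell of type (U; G; B; W). *)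
Lemma rinterp_typed G (t : rawterm M) U B W :
  typed G t U B W ->
  ctyped (rinterp t) (word1 U) (G : F) ([:: B] : F) (word1 W).
Proof.
move: G t U B W; apply: (@typed_mind M
  (fun G t U B W =>
     ctyped (rinterp t) (word1 U) (G : F) ([:: B] : F) (word1 W))
  (fun G ts U As W => if ts is [::] then [/\ G = [::], As = [::] & U = W] else
     ctyped (c_hs (map rinterp ts)) (word1 U) (G : F) (As : F) (word1 W))).
- exact: ctyped_mor1.
- move=> G [|t1 ts] t U0 As Un V B W //= _ _ H1 _ H2.
  by rewrite !word1_cat; apply: ct_v H1 H2.
- move=> D t v U B W /typed_ctx /= -> H.
  apply: (ctyped_ty (ct_v (ct_h (ct_one _)
    (ct_v (ctyped_mor1 v) (ct_ll _))) (ctyped_ty H _ _ _ _))) => //=.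
  by rewrite cats0.
- move=> A G t U B W /typed_ctx /= -> H /=.
  by apply: (ctyped_ty (ct_v (ct_h (ct_ur _) (ct_one _))
    (ctyped_ty H _ _ _ _))).
- move=> A G t U B W /typed_ctx /= -> H.
  rewrite size_rcons /= -cats1 take_size_cat //.
  apply: (ctyped_ty (ct_v (ct_h (ct_one _) (ct_ul _))
    (ctyped_ty H _ _ _ _))) => //=; by rewrite ?cats0 ?cats1.
- move=> D t v U B W /typed_ctx /= -> H.
  by apply: (ctyped_ty (ct_v (ct_h (ct_v (ctyped_mor1 v) (ct_lr _))
    (ct_one _)) (ctyped_ty H _ _ _ _))).
- by [].
- move=> G D t [|t1 ts] U V W A As _ H1 _ H2.
    by case: H2 => -> -> <-; rewrite cats0.
  exact: ct_h H1 H2.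
Qed.

Lemma rinterp_cell (t : term M) :
  exists U A B W, ctyped (rinterp (sval t)) U A B W.
Proof.
case: t => t /= [G [U [B [W H]]]].
by exists (word1 U), (G : F), ([:: B] : F), (word1 W); apply: rinterp_typed.
Qed.

Definition interp (t : term M) : cell F := exist _ _ (rinterp_cell t).

End Interpretation.

(* Main.v *)
(* Substituting values in a term amounts to composing vertically with the cell
   of those values; this is proved by induction on typing and gives [R0].
   Each put or get acts on the interpretation of its body as a corner cell P
   (preceded by a value for put) whiskered by vertical identities, on the left
   as (P | 1_D) . x and on the right as (1_D | Q) . x. By interchange, such a
   cell slides out of a horizontal composite ([R3]-[R6]), a left and a right one
   commute ([R7]-[R10]), and a facing right-left pair composes horizontally to a
   bare value by yanking ([R1], [R2]). *)
From Stdlib Require Import Setoid Morphisms.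
From mathcomp Require Import all_boot.
Require Import Defs.

Set Implicit Arguments.
Unset Strict Implicit.
Unset Printing Implicit Defensive.

Section Cells.
Variable S : strict_monoidal_category.
Implicit Types (a b c d x y P Q : cexpr S) (A B C D G X Y : S).
Implicit Types (U V W : polword S) (f g : smor S).

(** * Typing and equality of cell expressions *)

Lemma ctyped_cast a U A B W U' A' B' W' : ctyped a U A B W ->
  U = U' -> A = A' -> B = B' -> W = W' -> ctyped a U' A' B' W'.
Proof. by move=> H <- <- <- <-. Qed.

Lemma ctyped_c_v a b U A B W : ctyped (c_v a b) U A B W ->
  exists U1 U2 C W1 W2, [/\ ctyped a U1 A C W1, ctyped b U2 C B W2,
    U = U1 ++ U2 & W = W1 ++ W2].
Proof.
move=> H; inversion H; subst.
by exists U0, U', B0, W0, W'.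
Qed.

Lemma ctyped_c_h a b U A B W : ctyped (c_h a b) U A B W ->
  exists V A1 A2 B1 B2, [/\ ctyped a U A1 B1 V, ctyped b V A2 B2 W,
    A = sten A1 A2 & B = sten B1 B2].
Proof.
move=> H; inversion H; subst.
by exists W0, A0, A', B0, B'.
Qed.

(** Each generator determines its type, and the type of a composite is computed from those of its
    factors. *)
Lemma ctyped_unique a U A B W U' A' B' W' :
  ctyped a U A B W -> ctyped a U' A' B' W' ->
  [/\ U = U', A = A', B = B' & W = W'].
Proof.
move=> H; move: U' A' B' W'; elim: H => {a U A B W}.
- by move=> f U' A' B' W' H; inversion H.
- by move=> f U' A' B' W' H; inversion H.
- by move=> f U' A' B' W' H; inversion H.
- by move=> f U' A' B' W' H; inversion H.
- by move=> f U' A' B' W' H; inversion H.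
- by move=> f U' A' B' W' H; inversion H.
- by move=> f U' A' B' W' H; inversion H.
- move=> a b U1 U2 A C B W1 W2 _ IHa _ IHb U' A' B' W' /ctyped_c_v.
  move=> [U3 [U4 [D [W3 [W4 [/IHa [-> -> _ ->] /IHb [-> _ -> ->] -> ->]]]]]].
  by [].
- move=> a b U V W A1 A2 B1 B2 _ IHa _ IHb U' A' B' W' /ctyped_c_h.
  move=> [V' [A3 [A4 [B3 [B4 [/IHa [-> -> -> _] /IHb [_ -> -> ->] -> ->]]]]]].
  by [].
Qed.

Lemma ceq_ctyped a b U A B W :
  ceq a b U A B W -> ctyped a U A B W /\ ctyped b U A B W.
Proof.
elim=> {a b U A B W}.
- by [].
- by move=> a b U A B W _ [].
- by move=> a b c U A B W _ [? ?] _ [].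
- by move=> a a' b b' U U' A B C W W' _ [? ?] _ [? ?]; split; apply: ct_v; eauto.
- by move=> a a' b b' U U' A B C W W' _ [? ?] _ [? ?]; split; apply: ct_h; eauto.
- move=> f g e; split; last first.
    by apply: (ctyped_cast (ct_mor _)); rewrite ?sdom_comp ?scod_comp.
  apply: (@ct_v _ _ _ [::] [::] _ (scod f) _ [::] [::]); first exact: ct_mor.
  by apply: (ctyped_cast (ct_mor _)).
- move=> f g; split; first by apply: ct_h; exact: ct_mor.
  by apply: (ctyped_cast (ct_mor _)); rewrite ?sdom_ten ?scod_ten.
- move=> A; split; first exact: ct_one.
  by apply: (ctyped_cast (ct_mor _)); rewrite ?sdom_id ?scod_id.
- move=> A; split; last exact: ct_one.
  by apply: (ctyped_cast (ct_h (ct_ll _) (ct_ur _))); rewrite ?sten1l ?sten1r.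
- move=> A; split; last exact: ct_one.
  by apply: (ctyped_cast (ct_h (ct_ul _) (ct_lr _))); rewrite ?sten1l ?sten1r.
- move=> A; split; last exact: ct_id.
  by apply: (ctyped_cast (ct_v (ct_ur _) (ct_ll _))).
- move=> A; split; last exact: ct_id.
  by apply: (ctyped_cast (ct_v (ct_ul _) (ct_lr _))).
- move=> a b c U U' U'' A B C D W W' W'' ta tb tc; split.
    exact: ct_v ta (ct_v tb tc).
  by rewrite !catA; exact: ct_v (ct_v ta tb) tc.
- by move=> a U A B W t; split=> //; exact: (ct_v (ct_one _) t).
- move=> a U A B W t; split=> //.
  by apply: (ctyped_cast (ct_v t (ct_one _))); rewrite ?cats0.
- move=> a b c U V W X A A' A'' B B' B'' ta tb tc; split.
    exact: ct_h ta (ct_h tb tc).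
  by rewrite !stenA; exact: ct_h (ct_h ta tb) tc.
- move=> a U A B W t; split=> //.
  by apply: (ctyped_cast (ct_h (ct_id _) t)); rewrite ?sten1l.
- move=> a U A B W t; split=> //.
  by apply: (ctyped_cast (ct_h t (ct_id _))); rewrite ?sten1r.
- move=> a b c d U V W U' V' W' A A' B B' C C' ta tb tc td; split.
    exact: ct_v (ct_h ta tb) (ct_h tc td).
  exact: ct_h (ct_v ta tc) (ct_v tb td).
- by split; [exact: ct_id | exact: ct_one].
- by move=> U W; split; [exact: ct_v (ct_id _) (ct_id _) | exact: ct_id].
Qed.

(* Quantifying over all types of either side makes [ceqv] a congruence on
   untyped expressions: ill-typed expressions are only related to ill-typed
   ones, so rewriting with it generates no typing conditions. *)
Definition ceqv a b := forall U A B W,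
  ctyped a U A B W \/ ctyped b U A B W -> ceq a b U A B W.

Local Notation "a === b" := (ceqv a b) (at level 70).

(** By uniqueness of types, the type at which the equation was derived is the only one that either
    side can have. *)
Lemma ceq_ceqv a b U A B W : ceq a b U A B W -> a === b.
Proof.
move=> e U' A' B' W'; have [ta tb] := ceq_ctyped e.
by case=> [/(ctyped_unique ta)|/(ctyped_unique tb)] [<- <- <- <-].
Qed.

Lemma ceqv_refl a : a === a.
Proof. by move=> U A B W [] t; exact: ceq_refl. Qed.
#[local] Hint Resolve ceqv_refl : core.

#[global] Instance ceqv_equiv : Equivalence ceqv.
Proof.
split=> //.
- by move=> a b e U A B W t; apply: ceq_sym; apply: e; case: t; auto.
- move=> a b c e1 e2 U A B W [] t.
    (* The typing of [a] passes to [b] through the first equation, which makes the second one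
       applicable; below, the typing of [c] travels the other way. *)
    have e := e1 _ _ _ _ (or_introl t).
    by apply: ceq_trans e (e2 _ _ _ _ (or_introl (ceq_ctyped e).2)).
  have e := e2 _ _ _ _ (or_intror t).
  by apply: ceq_trans (e1 _ _ _ _ (or_intror (ceq_ctyped e).1)) e.
Qed.

#[global] Instance c_v_proper : Proper (ceqv ==> ceqv ==> ceqv) (@c_v S).
Proof.
move=> a a' ea b b' eb U A B W.
by case=> /ctyped_c_v [U1 [U2 [C [W1 [W2 [ta tb -> ->]]]]]];
  apply: (ceq_v (B := C)); [apply: ea | apply: eb | apply: ea | apply: eb]; auto.
Qed.

#[global] Instance c_h_proper : Proper (ceqv ==> ceqv ==> ceqv) (@c_h S).
Proof.
move=> a a' ea b b' eb U A B W.
by case=> /ctyped_c_h [V [A1 [A2 [B1 [B2 [ta tb -> ->]]]]]];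
  apply: (ceq_h (W := V)); [apply: ea | apply: eb | apply: ea | apply: eb]; auto.
Qed.

(** * Double category laws as rewriting rules *)

Lemma c_vA a b c : c_v a (c_v b c) === c_v (c_v a b) c.
Proof.
move=> U A B W [].
  move=> /ctyped_c_v [U1 [U2 [C [W1 [W2 [ta /ctyped_c_v]]]]]].
  move=> [U3 [U4 [D [W3 [W4 [tb tc -> ->]]]]]] -> ->.
  exact: ceq_vA ta tb tc.
move=> /ctyped_c_v [U1 [U2 [C [W1 [W2 [/ctyped_c_v]]]]]].
move=> [U3 [U4 [D [W3 [W4 [ta tb -> ->]]]]]] tc -> ->.
by rewrite -!catA; exact: ceq_vA ta tb tc.
Qed.

Lemma c_hA a b c : c_h a (c_h b c) === c_h (c_h a b) c.
Proof.
move=> U A B W [].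
  move=> /ctyped_c_h [V [A1 [A2 [B1 [B2 [ta /ctyped_c_h]]]]]].
  move=> [V' [A3 [A4 [B3 [B4 [tb tc -> ->]]]]]] -> ->.
  exact: ceq_hA ta tb tc.
move=> /ctyped_c_h [V [A1 [A2 [B1 [B2 [/ctyped_c_h]]]]]].
move=> [V' [A3 [A4 [B3 [B4 [ta tb -> ->]]]]]] tc -> ->.
by rewrite -!stenA; exact: ceq_hA ta tb tc.
Qed.

(** The typing hypothesis ties the object of the unit to the top boundary of [a]. *)
Lemma c_v1l a U A B W : ctyped a U A B W -> c_v (c_one A) a === a.
Proof. by move=> t; exact: ceq_ceqv (ceq_v1l t). Qed.

Lemma c_v1r a U A B W : ctyped a U A B W -> c_v a (c_one B) === a.
Proof. by move=> t; exact: ceq_ceqv (ceq_v1r t). Qed.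

Lemma c_h_interchange a b c d U V W U' V' W' A A' B B' C C' :
  ctyped a U A B W -> ctyped b W A' B' V ->
  ctyped c U' B C W' -> ctyped d W' B' C' V' ->
  c_v (c_h a b) (c_h c d) === c_h (c_v a c) (c_v b d).
Proof. by move=> ta tb tc td; exact: ceq_ceqv (ceq_interchange ta tb tc td). Qed.

Lemma c_one_mor A : c_one A === c_mor (sid A).
Proof. exact: ceq_ceqv (ceq_mor_id A). Qed.

Lemma c_mor_ten f g : c_mor (stenm f g) === c_h (c_mor f) (c_mor g).
Proof. by symmetry; exact: ceq_ceqv (ceq_mor_ten f g). Qed.

Lemma c_mor_comp f g : scod f = sdom g ->
  c_mor (scomp f g) === c_v (c_mor f) (c_mor g).
Proof. by move=> e; symmetry; exact: ceq_ceqv (ceq_mor_comp e). Qed.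

(** Vertical identities are cells of identity morphisms, so this is [stenm_id] transported from the
    monoidal category. *)
Lemma c_one_ten A B : c_one (sten A B) === c_h (c_one A) (c_one B).
Proof. by rewrite !c_one_mor -c_mor_ten stenm_id. Qed.

(** The vertical identity on the unit object is the horizontal identity on the empty word, hence
    neutral beside a cell whose left edge is empty. *)
Lemma c_h1l a A B W : ctyped a [::] A B W -> c_h (c_one sunit) a === a.
Proof.
move=> t; rewrite -(ceq_ceqv (ceq_id_nil S)).
exact: ceq_ceqv (ceq_h1l t).
Qed.

Lemma c_h1r a A B U : ctyped a U A B [::] -> c_h a (c_one sunit) === a.
Proof.
move=> t; rewrite -(ceq_ceqv (ceq_id_nil S)).
exact: ceq_ceqv (ceq_h1r t).
Qed.

Lemma ctyped_mor f A B : sdom f = A -> scod f = B ->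
  ctyped (c_mor f) [::] A B [::].
Proof. by move=> <- <-; exact: ct_mor. Qed.

(** * Horizontal composites of sequences of cells *)

Lemma c_hs_cons a s : 0 < size s -> c_hs (a :: s) = c_h a (c_hs s).
Proof. by case: s. Qed.

Lemma c_hs_rcons s a : 0 < size s -> c_hs (rcons s a) === c_h (c_hs s) a.
Proof.
elim: s => // b [|c s] IH _; first by [].
by rewrite rcons_cons (@c_hs_cons b) // IH // (@c_hs_cons b) // c_hA.
Qed.

Lemma c_hs_cat_proper s a a' s' : a === a' -> c_hs (s ++ a :: s') === c_hs (s ++ a' :: s').
Proof.
move=> e; elim: s => [|b s IH].
  by case: s' => [|c s'] //=; rewrite e.
by rewrite !cat_cons !(@c_hs_cons b) ?size_cat ?addnS // IH.
Qed.

(** Used for [R1] and [R2], where both members of a facing pair change and only their horizontal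
    composite is preserved. *)
Lemma c_hs_cat_proper2 s a b a' b' s' : c_h a b === c_h a' b' ->
  c_hs (s ++ [:: a, b & s']) === c_hs (s ++ [:: a', b' & s']).
Proof.
move=> e; elim: s => [|c s IH].
  by case: s' => [|c s'] //=; rewrite !c_hA e.
by rewrite !cat_cons !(@c_hs_cons c) ?size_cat ?addnS // IH.
Qed.

(** * Whiskered cells and interchange *)

(** By interchange both sides become P | 1_D | Q: the edges of [P] and [Q] that face each other are
    empty, so neither cell obstructs the other. *)
Lemma whisker_exchange P Q U W X Y X' Y' D :
  ctyped P U X Y [::] -> ctyped Q [::] X' Y' W ->
  c_v (c_h (c_one (sten X D)) Q) (c_h P (c_one (sten D Y')))
  === c_v (c_h P (c_one (sten D X'))) (c_h (c_one (sten Y D)) Q).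
Proof.
move=> tP tQ; rewrite !c_one_ten -!c_hA.
rewrite (c_h_interchange (ct_one _) (ct_h (ct_one _) tQ) tP
  (ct_h (ct_one _) (ct_one _))).
rewrite (c_h_interchange (ct_one _) tQ (ct_one _) (ct_one _)).
rewrite (c_h_interchange tP (ct_h (ct_one _) (ct_one _)) (ct_one _)
  (ct_h (ct_one _) tQ)).
rewrite (c_h_interchange (ct_one _) (ct_one _) (ct_one _) tQ).
by rewrite (c_v1l tP) (c_v1r tP) (c_v1l tQ) (c_v1r tQ).
Qed.

(** Both sides are ((f . P) | g) . x. This is the inductive step of substitution for left puts and
    gets: [f] is absorbed above [P], while [g] passes beside it into the body. *)
Lemma whiskerl_nat P f g U X Y x : ctyped P U X Y [::] -> scod f = X ->
  c_v (c_mor (stenm f g)) (c_v (c_h P (c_one (scod g))) x)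
  === c_v (c_h (c_v (c_mor f) P) (c_one (sdom g)))
        (c_v (c_mor (stenm (sid Y) g)) x).
Proof.
move=> tP e; rewrite !c_vA !c_mor_ten -c_one_mor.
have tf := ctyped_mor (erefl (sdom f)) e.
rewrite (c_h_interchange tf (ct_mor g) tP (ct_one _)).
rewrite (c_h_interchange (ct_v tf tP) (ct_one _) (ct_one _) (ct_mor g)).
by rewrite (c_v1l (ct_mor g)) (c_v1r (ct_mor g)) (c_v1r (ct_v tf tP)).
Qed.

Lemma whiskerr_nat Q f g W X Y x : ctyped Q [::] X Y W -> scod f = X ->
  c_v (c_mor (stenm g f)) (c_v (c_h (c_one (scod g)) Q) x)
  === c_v (c_h (c_one (sdom g)) (c_v (c_mor f) Q))
        (c_v (c_mor (stenm g (sid Y))) x).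
Proof.
move=> tQ e; rewrite !c_vA !c_mor_ten -c_one_mor.
have tf := ctyped_mor (erefl (sdom f)) e.
rewrite (c_h_interchange (ct_mor g) tf (ct_one _) tQ).
rewrite (c_h_interchange (ct_one _) (ct_v tf tQ) (ct_mor g) (ct_one _)).
by rewrite (c_v1l (ct_mor g)) (c_v1r (ct_mor g)) (c_v1r (ct_v tf tQ)).
Qed.

(** For [R3] and [R4]: writing [a] as 1_G . a, interchange lifts the whiskered [P] above the whole
    horizontal composite. *)
Lemma whiskerl_c_h P x a U X Y D U' B W G B' V :
  ctyped P U X Y [::] -> ctyped x U' (sten Y D) B W -> ctyped a W G B' V ->
  c_h (c_v (c_h P (c_one D)) x) a
  === c_v (c_h P (c_one (sten D G))) (c_h x a).
Proof.
move=> tP tx ta; rewrite c_one_ten c_hA.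
rewrite (c_h_interchange (ct_h tP (ct_one _)) (ct_one _) tx ta).
by rewrite (c_v1l ta).
Qed.

Lemma whiskerr_c_h Q x a U X Y D U' B W G B' V :
  ctyped Q [::] X Y U -> ctyped x W (sten D Y) B U' -> ctyped a V G B' W ->
  c_h a (c_v (c_h (c_one D) Q) x)
  === c_v (c_h (c_one (sten G D)) Q) (c_h a x).
Proof.
move=> tQ tx ta; rewrite c_one_ten -c_hA.
rewrite (c_h_interchange (ct_one _) (ct_h (ct_one _) tQ) ta tx).
by rewrite (c_v1l ta).
Qed.

(** Interchange puts [Q] and [P] side by side in a row above [x | y], where their composite can be
    replaced by the cell of [f]. *)
Lemma whisker_cancel P Q f x y w X Y X' Y' D G U B W B' V :
  ctyped Q [::] X Y w -> ctyped P w X' Y' [::] -> c_h Q P === c_mor f ->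
  ctyped x U (sten D Y) B W -> ctyped y W (sten Y' G) B' V ->
  c_h (c_v (c_h (c_one D) Q) x) (c_v (c_h P (c_one G)) y)
  === c_v (c_h (c_one D) (c_h (c_mor f) (c_one G))) (c_h x y).
Proof.
move=> tQ tP e tx ty.
rewrite -(c_h_interchange (ct_h (ct_one _) tQ) (ct_h tP (ct_one _)) tx ty).
by rewrite -c_hA (@c_hA Q) e.
Qed.

(** The case of [R1]: [Q] is a put and has the unit as its bottom, so [x] receives nothing and the
    value [f] enters [y], the body of the get. *)
Lemma whisker_cancell P Q f x y w X X' Y' D G U B W B' V :
  ctyped Q [::] X sunit w -> ctyped P w X' Y' [::] -> c_h Q P === c_mor f ->
  scod f = Y' ->
  ctyped x U D B W -> ctyped y W (sten Y' G) B' V ->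
  c_h (c_v (c_h (c_one D) Q) x) (c_v (c_h P (c_one G)) y)
  === c_h x (c_v (c_mor (stenm f (sid G))) y).
Proof.
move=> tQ tP e ef tx ty.
have tx' : ctyped x U (sten D sunit) B W by rewrite sten1r.
rewrite (whisker_cancel tQ tP e tx' ty) c_mor_ten -c_one_mor.
have tf := ctyped_mor (erefl (sdom f)) ef.
rewrite (c_h_interchange (ct_one _) (ct_h tf (ct_one _)) tx ty).
by rewrite (c_v1l tx).
Qed.

(** The mirror case of [R2]: now [P] is the put, and the value enters [x]. *)
Lemma whisker_cancelr P Q f x y w X X' Y D G U B W B' V :
  ctyped Q [::] X Y w -> ctyped P w X' sunit [::] -> c_h Q P === c_mor f ->
  scod f = Y ->
  ctyped x U (sten D Y) B W -> ctyped y W G B' V ->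
  c_h (c_v (c_h (c_one D) Q) x) (c_v (c_h P (c_one G)) y)
  === c_h (c_v (c_mor (stenm (sid D) f)) x) y.
Proof.
move=> tQ tP e ef tx ty.
have ty' : ctyped y W (sten sunit G) B' V by rewrite sten1l.
rewrite (whisker_cancel tQ tP e tx ty') c_mor_ten -c_one_mor c_hA.
have tf := ctyped_mor (erefl (sdom f)) ef.
rewrite (c_h_interchange (ct_h (ct_one _) tf) (ct_one _) tx ty).
by rewrite (c_v1l ty).
Qed.

(** * Yanking with a value above one corner *)

Lemma yank_circ f A : scod f = A ->
  c_h (c_v (c_mor f) (c_ll A)) (c_ur A) === c_mor f.
Proof.
move=> e; have tf := ctyped_mor (erefl (sdom f)) e.
(* The bare corner is padded above by the identity on the unit object, so that both factors are
   vertical composites and interchange exposes the yanking equation. *)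
rewrite -{1}(c_v1l (ct_ur A)).
rewrite -(c_h_interchange tf (ct_one _) (ct_ll A) (ct_ur A)).
by rewrite (ceq_ceqv (ceq_yank_h_circ A)) (c_h1r tf) (c_v1r tf).
Qed.

Lemma yank_bullet f A : scod f = A ->
  c_h (c_ul A) (c_v (c_mor f) (c_lr A)) === c_mor f.
Proof.
move=> e; have tf := ctyped_mor (erefl (sdom f)) e.
rewrite -{1}(c_v1l (ct_ul A)).
rewrite -(c_h_interchange (ct_one _) tf (ct_ul A) (ct_lr A)).
by rewrite (ceq_ceqv (ceq_yank_h_bullet A)) (c_h1l tf) (c_v1r tf).
Qed.

End Cells.

#[local] Hint Resolve ceqv_refl : core.
Local Notation "a === b" := (ceqv a b) (at level 70).

Section Soundness.
Variable M : multicategory.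
Local Notation F := (free_smc M).
Implicit Types (A B C : M) (G D : seq M) (U V W : polword M).
Implicit Types (u v w : mor M) (vs : seq (mor M)) (r s t : rawterm M).
Implicit Types (a b ts : seq (rawterm M)).

(** * Typing judgements of terms and of let sequences *)

Definition ctxs ts := flatten (map (@ctx M) ts).

Lemma typed_let G ts t U B W : typed G (t_let ts t) U B W ->
  0 < size ts /\ exists U0 As Un V W', [/\ typeds G ts U0 As Un,
    typed As t V B W', U = U0 ++ V & W = Un ++ W'].
Proof.
by move=> H; inversion H; subst; split=> //; exists U0, As, Un, V, W0.
Qed.

Lemma typed_putR G v t U B W : typed G (t_putR v t) U B W ->
  exists D W', [/\ typed D t U B W', G = D ++ mdom v
    & W = circ (mcod v) :: W'].
Proof. by move=> H; inversion H; subst; exists D, W0. Qed.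

Lemma typed_putL G v t U B W : typed G (t_putL v t) U B W ->
  exists D U', [/\ typed D t U' B W, G = mdom v ++ D
    & U = bullet (mcod v) :: U'].
Proof. by move=> H; inversion H; subst; exists D, U0. Qed.

Lemma typed_getL G A t U B W : typed G (t_getL A t) U B W ->
  exists U', typed (A :: G) t U' B W /\ U = circ A :: U'.
Proof. by move=> H; inversion H; subst; exists U0. Qed.

Lemma typed_getR G A t U B W : typed G (t_getR A t) U B W ->
  exists W', typed (rcons G A) t U B W' /\ W = bullet A :: W'.
Proof. by move=> H; inversion H; subst; exists W0. Qed.

Lemma typeds_cons G t ts U As W : typeds G (t :: ts) U As W ->
  exists G1 G2 V A As', [/\ typed G1 t U A V, typeds G2 ts V As' W,
    G = G1 ++ G2 & As = A :: As'].
Proof. by move=> H; inversion H; subst; exists G0, D, V, A, As0. Qed.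

Lemma typeds_cat G a b U As W : typeds G (a ++ b) U As W ->
  exists G1 G2 V As1 As2, [/\ typeds G1 a U As1 V, typeds G2 b V As2 W,
    G = G1 ++ G2 & As = As1 ++ As2].
Proof.
elim: a G U As => [|t a IH] G U As.
  by move=> H; exists [::], G, U, [::], As; split=> //; constructor.
move=> /typeds_cons [G1 [G2 [V [A [As1 [ty /IH]]]]]].
move=> [G3 [G4 [V' [As2 [As3 [tya tyb -> ->]]]]]] -> ->.
exists (G1 ++ G3), G4, V', (A :: As2), As3; split=> //; last by rewrite catA.
exact: tys_cons ty tya.
Qed.

Lemma typeds_ctxs G ts U As W : typeds G ts U As W -> ctxs ts = G.
Proof. by elim=> // ? ? ? ? ? ? ? ? ? /typed_ctx <- _ <-. Qed.

(** Nonemptiness matters: the empty sequence is typed with an arbitrary word on both sides, while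
    [c_hs [::]] has only empty edges. *)
Lemma typeds_c_hs G ts U As W : typeds G ts U As W -> 0 < size ts ->
  ctyped (c_hs (map (@rinterp M) ts)) (word1 U) (G : F) (As : F) (word1 W).
Proof.
elim=> // G1 G2 t {}ts U1 V W1 A As1 /rinterp_typed tt ty IH _.
case: ts ty IH => [|t' ts] ty IH /=; last exact: ct_h tt (IH isT).
inversion ty; subst; rewrite cats0; exact: tt.
Qed.

(** * Interpretation of value substitution *)

Lemma fcomp1 vs v : fcod vs = mdom v -> fcomp vs [:: v] = [:: mcomp v vs].
Proof. by move=> e; rewrite /= take_oversize // -e size_map. Qed.

Lemma c_mor_mcomp vs v : fcod vs = mdom v ->
  c_mor ([:: mcomp v vs] : smor F)
  === c_v (c_mor (vs : smor F)) (c_mor ([:: v] : smor F)).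
Proof.
move=> e; rewrite -fcomp1 //; apply: (@c_mor_comp F vs [:: v]).
by rewrite /= /fdom /= cats0.
Qed.

(** The empty sequence is the identity of F(M) on the empty list. It appears above the corner of a
    get, where no value is substituted. *)
Lemma c_mor_nil_v (x : cexpr F) (U W : polword F) (X : F) :
  ctyped x U ([::] : F) X W -> c_v (c_mor ([::] : smor F)) x === x.
Proof. by move=> tx; rewrite -(@c_one_mor F [::]) (c_v1l tx). Qed.

Lemma take_size_rcons (T : Type) (x : T) (s : seq T) :
  take (size (rcons s x)).-1 (rcons s x) = s.
Proof. by rewrite size_rcons -cats1 take_size_cat. Qed.

(** A name for the local fixpoint inside [subst], with the same body so that [subst_let] holds by
    conversion. *)
Definition substs := fix substs ts vs :=
  if ts is t1 :: ts' then
    subst t1 (take (size (ctx t1)) vs) :: substs ts' (drop (size (ctx t1)) vs)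
  else [::].

Lemma subst_let ts s vs : subst (t_let ts s) vs = t_let (substs ts vs) s.
Proof. by []. Qed.

(** The context equation is proved along with the cell equation because the vertical identities in
    the interpretation of a put or get are indexed by the context of its body. *)
Lemma rinterp_subst G t U B W : typed G t U B W ->
  forall vs, fcod vs = G ->
  ctx (subst t vs) = fdom vs
  /\ rinterp (subst t vs) === c_v (c_mor (vs : smor F)) (rinterp t).
Proof.
move: G t U B W; apply: (@typed_mind M
  (fun G t U B W => forall vs, fcod vs = G ->
     ctx (subst t vs) = fdom vs
     /\ rinterp (subst t vs) === c_v (c_mor (vs : smor F)) (rinterp t))
  (fun G ts U As W => forall vs, fcod vs = G ->
     ctxs (substs ts vs) = fdom vs
     /\ (0 < size ts -> c_hs (map (@rinterp M) (substs ts vs))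
        === c_v (c_mor (vs : smor F)) (c_hs (map (@rinterp M) ts))))).
- move=> v vs e; split; first exact: mdom_comp.
  exact: c_mor_mcomp.
- move=> G ts t U0 As Un V B W ts0 _ IH _ _ vs e; rewrite subst_let.
  have [ec ei] := IH vs e; split; first exact: ec.
  by rewrite /= ei // c_vA.
- move=> D t v U B W /typed_ctx ty IH vs /fcod_split /= [e1 e2].
  rewrite ty; set vs1 := take _ _ in e1 *; set vs2 := drop _ _ in e2 *.
  have evs : vs = vs1 ++ vs2 by rewrite cat_take_drop.
  have [-> ->] := IH _ e1.
  rewrite mdom_comp // mcod_comp // (c_mor_mcomp e2) -c_vA evs fdom_cat.
  split=> //; symmetry; rewrite -e1.
  (* The values [vs2] are absorbed by the put; [vs1] passes beside it into the body. *)
  have := @whiskerr_nat F _ (vs2 : smor F) (vs1 : smor F) _ _ _ (rinterp t)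
    (ct_v (ctyped_mor1 v) (ct_ll ([:: mcod v] : F))) e2.
  by rewrite /= cats0.
- move=> A G t U B W /typed_ctx ty IH vs e /=.
  have [|-> ->] := IH (mid A :: vs); first by rewrite /= mcod_id e.
  rewrite ty /fdom /= mdom_id; split=> //; symmetry; rewrite -e.
  (* Nothing lies above the corner, and the identity on [A] tensored with [vs] is [mid A :: vs]: the
     bound variable is substituted for itself. *)
  have := @whiskerl_nat F _ ([::] : smor F) (vs : smor F) _ _ _ (rinterp t)
    (ct_ur ([:: A] : F)) erefl.
  by rewrite (c_mor_nil_v (ct_ur ([:: A] : F))).
- move=> A G t U B W /typed_ctx ty IH vs e /=.
  have [|-> ->] := IH (rcons vs (mid A)).
    by rewrite /fcod map_rcons mcod_id -/(fcod _) e.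
  have -> : fdom (rcons vs (mid A)) = rcons (fdom vs) A.
    by rewrite -cats1 fdom_cat /fdom /= mdom_id cats1.
  rewrite ty !take_size_rcons; split=> //; symmetry; rewrite -e -cats1.
  have := @whiskerr_nat F _ ([::] : smor F) (vs : smor F) _ _ _ (rinterp t)
    (ct_ul ([:: A] : F)) erefl.
  by rewrite (c_mor_nil_v (ct_ul ([:: A] : F))) /= cats0.
- move=> D t v U B W /typed_ctx ty IH vs /fcod_split /= [e1 e2].
  rewrite ty; set vs1 := take _ _ in e1 *; set vs2 := drop _ _ in e2 *.
  have evs : vs = vs1 ++ vs2 by rewrite cat_take_drop.
  have [-> ->] := IH _ e2.
  rewrite mdom_comp // mcod_comp // (c_mor_mcomp e1) -c_vA evs fdom_cat.
  split=> //; symmetry; rewrite -e2.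
  exact: (@whiskerl_nat F _ (vs1 : smor F) (vs2 : smor F) _ _ _ (rinterp t)
    (ct_v (ctyped_mor1 v) (ct_lr ([:: mcod v] : F))) e1).
- by move=> U [].
- move=> G D t ts U V W A As ty IH tys IHs vs /fcod_split /= [e1 e2].
  rewrite (typed_ctx ty).
  set vs1 := take _ _ in e1 *; set vs2 := drop _ _ in e2 *.
  have evs : vs = vs1 ++ vs2 by rewrite cat_take_drop.
  have [ec ei] := IH _ e1; have [ecs eis] := IHs _ e2.
  rewrite /ctxs /= ec -/(ctxs _) ecs evs fdom_cat; split=> // _.
  (* [c_hs] leaves a lone cell uncomposed, so the end of the sequence is treated apart; there no
     values remain and [vs2] is empty. *)
  case: ts tys eis {IHs ecs} => [|t' ts] tys eis.
    have -> : vs2 = [::].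
      by apply: size0nil; rewrite -(size_map mcod) -/(fcod _) e2; inversion tys.
    by rewrite cats0.
  have etens : c_mor (vs1 ++ vs2 : smor F)
    === c_h (c_mor (vs1 : smor F)) (c_mor (vs2 : smor F)) := @c_mor_ten F vs1 vs2.
  move: (eis isT) => /= {}eis; rewrite ei eis etens.
  symmetry; exact: c_h_interchange (@ctyped_mor F vs1 _ _ erefl e1)
    (@ctyped_mor F vs2 _ _ erefl e2) (rinterp_typed ty) (typeds_c_hs tys isT).
Qed.

(** * Let sequences of values, and of components with a whiskered end *)

Lemma c_hs_seq vs : 0 < size vs ->
  c_hs (map (@rinterp M) (map (@t_seq M) vs)) === c_mor (vs : smor F).
Proof.
elim: vs => // v [|v' vs] IH _ //.
move: (IH isT) => /= {}IH; rewrite IH.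
exact: (ceq_ceqv (@ceq_mor_ten F [:: v] (v' :: vs))).
Qed.

Lemma typeds_seq G vs U As W :
  typeds G (map (@t_seq M) vs) U As W -> fcod vs = As.
Proof.
elim: vs G U As => [|v vs IH] G U As; first by move=> H; inversion H.
move=> /typeds_cons [G1 [G2 [V [A [As' [H /IH <- _ ->]]]]]].
by inversion H.
Qed.

(** Extends [whiskerl_c_h] to all remaining components of a let at once; when there are none, they
    add nothing to the whiskering identity. *)
Lemma c_hs_whiskerl (P x : cexpr F) (U U' : polword F) (X Y D B : F) a
    Ga (W0 W1 : polword M) As :
  ctyped P U X Y [::] -> ctyped x U' (Y ++ D : F) B (word1 W0) ->
  typeds Ga a W0 As W1 ->
  c_hs (c_v (c_h P (c_one D)) x :: map (@rinterp M) a)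
  === c_v (c_h P (c_one (D ++ ctxs a : F))) (c_hs (x :: map (@rinterp M) a)).
Proof.
move=> tP tx tya; case: a tya => [|t a] tya; first by rewrite /= cats0.
rewrite (typeds_ctxs tya) (@c_hs_cons _ x) ?(@c_hs_cons _ (c_v _ _)) //.
exact: whiskerl_c_h tP tx (typeds_c_hs tya isT).
Qed.

Lemma c_hs_whiskerr (Q x : cexpr F) (U U' : polword F) (X Y D B : F) a
    Ga (W0 W1 : polword M) As :
  ctyped Q [::] X Y U -> ctyped x (word1 W1) (D ++ Y : F) B U' ->
  typeds Ga a W0 As W1 ->
  c_hs (rcons (map (@rinterp M) a) (c_v (c_h (c_one D) Q) x))
  === c_v (c_h (c_one (ctxs a ++ D : F)) Q)
        (c_hs (rcons (map (@rinterp M) a) x)).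
Proof.
move=> tQ tx tya; case: a tya => [|t a] tya; first by [].
rewrite (typeds_ctxs tya) !c_hs_rcons //.
exact: whiskerr_c_h tQ tx (typeds_c_hs tya isT).
Qed.

(** The exchange law in the shape that [R7]-[R10] take after interpretation: [x] is the body, and
    [D] the context lying between the variables handled on the left and on the right. *)
Lemma whisker_swap (P Q x : cexpr F) (U W : polword F) (X Y X' Y' D : F) :
  ctyped P U X Y [::] -> ctyped Q [::] X' Y' W ->
  c_v (c_h (c_one (X ++ D : F)) Q) (c_v (c_h P (c_one (D ++ Y' : F))) x)
  === c_v (c_h P (c_one (D ++ X' : F))) (c_v (c_h (c_one (Y ++ D : F)) Q) x).
Proof.
move=> tP tQ; have e := @whisker_exchange F _ _ _ _ _ _ _ _ D tP tQ.
by rewrite !c_vA; rewrite /= in e; rewrite e.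
Qed.

Lemma ctyped_putl v : ctyped (c_v (c_mor ([:: v] : smor F))
    (c_lr ([:: mcod v] : F))) (word1 [:: bullet (mcod v)])
  (mdom v : F) ([::] : F) [::].
Proof. exact: ct_v (ctyped_mor1 v) (ct_lr _). Qed.

Lemma ctyped_putr v : ctyped (c_v (c_mor ([:: v] : smor F))
    (c_ll ([:: mcod v] : F))) [::]
  (mdom v : F) ([::] : F) (word1 [:: circ (mcod v)]).
Proof. exact: ct_v (ctyped_mor1 v) (ct_ll _). Qed.

Lemma ctyped_getl A : ctyped (c_ur ([:: A] : F)) (word1 [:: circ A])
  ([::] : F) ([:: A] : F) [::].
Proof. exact: ct_ur. Qed.

Lemma ctyped_getr A : ctyped (c_ul ([:: A] : F)) [::]
  ([::] : F) ([:: A] : F) (word1 [:: bullet A]).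
Proof. exact: ct_ul. Qed.

Lemma ctxs_cat a b : ctxs (a ++ b) = ctxs a ++ ctxs b.
Proof. by rewrite /ctxs map_cat flatten_cat. Qed.

Lemma ctxs_rcons a t : ctxs (rcons a t) = ctxs a ++ ctx t.
Proof. by rewrite -cats1 ctxs_cat /ctxs /= cats0. Qed.

(** * Soundness of the rewriting rules *)

(** Preservation of contexts is part of the induction: an enclosing put or get is whiskered by an
    identity on the context of its body, so closure under term formers requires it. *)
Lemma step_sound t t' : step t t' -> forall G U B W, typed G t U B W ->
  ctx t' = ctx t /\ rinterp t === rinterp t'.
Proof.
elim=> {t t'}.
- move=> vs t G U B W /[dup] ty.
  move=> /typed_let [vs0 [U0 [As [Un [V [W' [tys tyt _ _]]]]]]].
  (* Typing of the let makes the codomains of the values equal to the context of the body, as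
     substitution requires. *)
  have [ec ei] := rinterp_subst tyt (typeds_seq tys).
  split; first by rewrite ec /= -map_comp.
  by rewrite ei [rinterp (t_let _ _)]/= c_hs_seq // -(size_map (@t_seq M)).
- move=> a b v t A D s r eD G U B W.
  move=> /typed_let [_ [U0 [As [Un [V [W' [/typeds_cat H _ _ _]]]]]]].
  case: H => [G1 [G2 [V2 [As1 [As2 [_ + _ _]]]]]].
  move=> /typeds_cons [G3 [G4 [V3 [C [As3 [ty1 + _ _]]]]]].
  move=> /typeds_cons [G5 [G6 [V4 [E [As4 [ty2 _ _ _]]]]]].
  have [D1 [W1 [tyt eG3 eV3]]] := typed_putR ty1.
  have [U1 [tys eV3']] := typed_getL ty2.
  (* The facing components share the word [V3]; its first letter comes from the put and from the get
     alike, so the received type is [mcod v]. *)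
  move: eV3'; rewrite eV3 => -[eA eW1]; subst A U1.
  have eG5 : D = G5 by move: (typed_ctx tys); rewrite eD => -[].
  subst G5.
  have [|ec ei] := rinterp_subst tys (vs := v :: map mid D).
    by rewrite /= -/(fid D) fcod_id.
  have ecD : fdom (v :: map mid D) = mdom v ++ D.
    by rewrite -{2}(fdom_id D).
  split.
    rewrite /= -!/(ctxs _) !ctxs_cat /ctxs /= ec ecD eD /=.
    by rewrite !catA.
  rewrite /= !map_cat; apply: c_v_proper => //.
  apply: c_hs_cat_proper2; rewrite ei /= eD /= (typed_ctx tyt).
  exact: (@whisker_cancell F _ _ [:: v] _ _ _ _ _ _ _ _ _ _ _ _ _
    (ctyped_putr v) (ctyped_getl _) (@yank_circ F [:: v] _ erefl) erefl
    (rinterp_typed tyt) (rinterp_typed tys)).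
- move=> a b A D t v s r eD G U B W.
  move=> /typed_let [_ [U0 [As [Un [V [W' [/typeds_cat H _ _ _]]]]]]].
  case: H => [G1 [G2 [V2 [As1 [As2 [_ + _ _]]]]]].
  move=> /typeds_cons [G3 [G4 [V3 [C [As3 [ty1 + _ _]]]]]].
  move=> /typeds_cons [G5 [G6 [V4 [E [As4 [ty2 _ _ _]]]]]].
  have [W1 [tyt eV3]] := typed_getR ty1.
  have [D1 [U1 [tys eG5 eV3']]] := typed_putL ty2.
  move: eV3; rewrite eV3' => -[eA eW1]; subst A U1.
  have eG3 : D = G3 by move: (typed_ctx tyt); rewrite eD => /rcons_inj [].
  subst G3.
  have [|ec ei] := rinterp_subst tyt (vs := rcons (map mid D) v).
    by rewrite /fcod map_rcons -/(fid D) -/(fcod _) fcod_id.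
  have ecD : fdom (rcons (map mid D) v) = D ++ mdom v.
    by rewrite -cats1 fdom_cat -/(fid D) fdom_id /fdom /= cats0.
  split.
    rewrite /= -!/(ctxs _) !ctxs_cat /ctxs /= ec ecD eD take_size_rcons.
    by rewrite -!catA.
  rewrite /= !map_cat; apply: c_v_proper => //.
  apply: c_hs_cat_proper2; rewrite ei /= eD take_size_rcons (typed_ctx tys).
  have := rinterp_typed tyt; rewrite -!cats1 => tt.
  exact: (@whisker_cancelr F _ _ [:: v] _ _ _ _ _ _ _ _ _ _ _ _ _
    (ctyped_getr _) (ctyped_putl v) (@yank_bullet F [:: v] _ erefl) erefl
    tt (rinterp_typed tys)).
- move=> v t a r G U B W.
  move=> /typed_let [_ [U0 [As [Un [V [W' [+ _ _ _]]]]]]].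
  move=> /typeds_cons [G1 [G2 [V2 [A [As1 [ty tya _ _]]]]]].
  have [D [U1 [tyt _ _]]] := typed_putL ty.
  split; first by rewrite /= catA.
  have := c_hs_whiskerl (ctyped_putl v) (D := D) (rinterp_typed tyt) tya.
  by rewrite /= (typed_ctx tyt) => ->; rewrite c_vA.
- move=> A t a r G U B W.
  move=> /typed_let [_ [U0 [As [Un [V [W' [+ _ _ _]]]]]]].
  move=> /typeds_cons [G1 [G2 [V2 [C [As1 [ty tya _ _]]]]]].
  have [U1 [tyt _]] := typed_getL ty.
  split; first by rewrite /= (typed_ctx tyt).
  have := c_hs_whiskerl (ctyped_getl A) (D := G1) (rinterp_typed tyt) tya.
  by rewrite /= (typed_ctx tyt) => ->; rewrite c_vA.
- move=> v t a r G U B W.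
  move=> /typed_let [_ [U0 [As [Un [V [W' [+ _ _ _]]]]]]].
  rewrite -cats1 => /typeds_cat [G1 [G2 [V2 [As1 [As2 [tya + _ _]]]]]].
  move=> /typeds_cons [G3 [G4 [V3 [A [As3 [ty _ _ _]]]]]].
  have [D [W1 [tyt _ _]]] := typed_putR ty.
  split; first by rewrite cats1 /= -!/(ctxs _) !ctxs_rcons /= catA.
  (* The bottom of a put cell is the unit, so the context of the body is displayed with an empty
     right factor. *)
  have tyt' : ctyped (rinterp t) (word1 V2) (D ++ [::] : F) ([:: A] : F)
    (word1 W1) by rewrite cats0; exact: rinterp_typed tyt.
  rewrite cats1 [rinterp (t_let _ _)]/= map_rcons /= (typed_ctx tyt).
  rewrite (c_hs_whiskerr (ctyped_putr v) tyt' tya).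
  by rewrite -/(ctxs _) ctxs_rcons (typed_ctx tyt) c_vA map_rcons.
- move=> A t a r G U B W.
  move=> /typed_let [_ [U0 [As [Un [V [W' [+ _ _ _]]]]]]].
  rewrite -cats1 => /typeds_cat [G1 [G2 [V2 [As1 [As2 [tya + _ _]]]]]].
  move=> /typeds_cons [G3 [G4 [V3 [C [As3 [ty _ _ _]]]]]].
  have [W1 [tyt _]] := typed_getR ty.
  have ect : ctxs a ++ rcons G3 A = rcons (ctxs a ++ G3) A.
    by rewrite -!cats1 catA.
  split.
    rewrite cats1 /= -!/(ctxs _) !ctxs_rcons /= (typed_ctx tyt).
    by rewrite ect !take_size_rcons.
  have tyt' : ctyped (rinterp t) (word1 V2) (G3 ++ [:: A] : F) ([:: C] : F)
    (word1 W1) by rewrite cats1; exact: rinterp_typed tyt.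
  rewrite cats1 [rinterp (t_let _ _)]/= map_rcons /= (typed_ctx tyt).
  rewrite take_size_rcons (c_hs_whiskerr (ctyped_getr A) tyt' tya).
  rewrite -/(ctxs _) ctxs_rcons (typed_ctx tyt) ect take_size_rcons.
  by rewrite c_vA map_rcons.
- move=> v w t G U B W ty.
  have [D [W1 [/typed_putL [D1 [U1 [tyt _ _]]] _ _]]] := typed_putR ty.
  split; first by rewrite /= catA.
  have := whisker_swap (x := rinterp t) (D := D1) (ctyped_putl w) (ctyped_putr v).
  by rewrite /= (typed_ctx tyt) cats0.
- move=> v A t G U B W ty.
  have [D [W1 [/typed_getL [U1 [tyt _]] _ _]]] := typed_putR ty.
  split; first by rewrite /= (typed_ctx tyt).
  have := whisker_swap (x := rinterp t) (D := D) (ctyped_getl A) (ctyped_putr v).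
  by rewrite /= (typed_ctx tyt) /= cats0.
- move=> A v t nt G U B W ty.
  have [W1 [/typed_putL [D1 [U1 [tyt eG _]]] _]] := typed_getR ty.
  (* As the context of [t] is not empty, its last variable is the last one of the whole context,
     hence the one bound by [getR]; [D] is what remains. *)
  move: nt eG; rewrite (typed_ctx tyt); case/lastP: D1 tyt => // D C tyt _.
  rewrite -rcons_cat => /rcons_inj [eG eA]; subst C.
  have ect : mdom v ++ rcons D A = rcons (mdom v ++ D) A.
    by rewrite rcons_cat.
  split; first by rewrite /= (typed_ctx tyt) ect !take_size_rcons.
  have := whisker_swap (x := rinterp t) (D := D) (ctyped_putl v) (ctyped_getr A).
  by rewrite /= (typed_ctx tyt) ect !take_size_rcons cats0 cats1.
- move=> A C t G U B W ty.
  have [W1 [/typed_getL [U1 [tyt _]] _]] := typed_getR ty.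
  have ect := take_size_rcons A (C :: G).
  split.
    rewrite [LHS]/= [RHS]/= (typed_ctx tyt) ect.
    exact: (esym (take_size_rcons A G)).
  have := whisker_swap (x := rinterp t) (D := G) (ctyped_getl C) (ctyped_getr A).
  rewrite [rinterp (t_getR _ _)]/= [rinterp (t_getL _ (t_getR _ _))]/=.
  rewrite (typed_ctx tyt) ect [behead _]/= take_size_rcons.
  by rewrite /= cats0 cats1.
- move=> a t t' b r _ IH G U B W.
  move=> /typed_let [_ [U0 [As [Un [V [W' [/typeds_cat H _ _ _]]]]]]].
  case: H => [G1 [G2 [V2 [As1 [As2 [_ + _ _]]]]]].
  move=> /typeds_cons [G3 [G4 [V3 [C [As3 [/IH [ec ei] _ _ _]]]]]].
  split; first by rewrite /= -!/(ctxs _) !ctxs_cat /ctxs /= ec.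
  by rewrite /= !map_cat; apply: c_v_proper => //; apply: c_hs_cat_proper.
- move=> ts r r' _ IH G U B W.
  move=> /typed_let [_ [U0 [As [Un [V [W' [_ /IH [_ ei] _ _]]]]]]].
  by split=> //=; rewrite ei.
- move=> v t t' _ IH G U B W /typed_putR [D [W' [/IH [ec ei] _ _]]].
  by split; rewrite /= ?ec // ei.
- move=> A t t' _ IH G U B W /typed_getL [U' [/IH [ec ei] _]].
  by split; rewrite /= ?ec // ei.
- move=> A t t' _ IH G U B W /typed_getR [W' [/IH [ec ei] _]].
  by split; rewrite /= ?ec // ei.
- move=> v t t' _ IH G U B W /typed_putL [D [U' [/IH [ec ei] _ _]]].
  by split; rewrite /= ?ec // ei.
Qed.

End Soundness.

Theorem lemma3p8 (M : multicategory) (t t' : term M) :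
  convertible t t' -> same_cell (interp t) (interp t').
Proof.
move=> c; have e : ceqv (rinterp (sval t)) (rinterp (sval t')).
  (* Every intermediate term of a conversion is well typed, so each step is covered by [step_sound];
     the closure is immediate since [ceqv] is an equivalence. *)
  elim: c => {t t'}.
  - move=> [t [G [U [B [W ty]]]]] t' /step_sound st.
    by have [] := st _ _ _ _ ty.
  - by [].
  - by move=> t t' _ e; symmetry.
  - by move=> t1 t2 t3 _ e1 _ e2; transitivity (rinterp (sval t2)).
(* A type is fixed only now: the one of the interpretation of [t]. *)
have [U [A [B [W ty]]]] := rinterp_cell t.
by exists U, A, B, W; apply: e; left.
Qed.
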